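(* Let $\mathfrak g$ be a unimodular real Lie algebra of dimension $2n$ endowed with an abelian balanced Hermitian structure $(J,F)$, let $\nabla$ be the associated Bismut connection, and let $\mathfrak z$ be the center of $\mathfrak g$. If $\dim\mathfrak z=2k$, then $\mathfrak{hol}(\nabla)\subseteq\mathfrak{su}(n-k)$.
   Context: A complex structure on a real Lie algebra $\mathfrak g$ is a linear map $J:\mathfrak g\to\mathfrak g$ with $J^2=-\mathrm{Id}$ and $[JX,JY]-J[JX,Y]-J[X,JY]-[X,Y]=0$ for all $X,Y$; it is abelian if $[JX,JY]=[X,Y]$ for all $X,Y$. A Hermitian structure on $\mathfrak g$ ($\dim\mathfrak g=2n$) is a pair $(J,g)$ with $J$ a complex structure and $g$ an inner product such that $g(JX,JY)=g(X,Y)$; it is equivalently denoted $(J,F)$, where $F(X,Y)=g(X,JY)$ is the fundamental form. The differential $d$ on $\bigwedge^*\mathfrak g^*$ is the Chevalley-Eilenberg differential, with $d\alpha(X,Y)=-\alpha([X,Y])$ for $\alpha\in\mathfrak g^*$. $(J,F)$ is balanced if $d(F^{n-1})=0$ (equivalently $d^*F=0$); it is an abelian balanced Hermitian structure if $J$ is abelian and $F$ is balanced. $\mathfrak g$ is unimodular if $\operatorname{tr}\operatorname{ad}_X=0$ for all $X$. Bismut connection: with $\nabla^g$ the Levi-Civita connection, $2g(\nabla^g_XY,Z)=g([X,Y],Z)-g([Y,Z],X)+g([Z,X],Y)$, and $T(X,Y,Z)=-dF(JX,JY,JZ)$, the Bismut connection is the bilinear map $\nabla:\mathfrak g\times\mathfrak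 g\to\mathfrak g$ given by $g(\nabla_XY,Z)=g(\nabla^g_XY,Z)+\frac12T(X,Y,Z)$ (it is viewed as a left-invariant connection on a Lie group with Lie algebra $\mathfrak g$). $\mathfrak{hol}(\nabla)\subseteq\mathfrak{so}(\mathfrak g,g)$ is the Lie algebra of its (restricted) holonomy group; by Ambrose-Singer it is generated by the curvature endomorphisms $R(X,Y)=[\nabla_X,\nabla_Y]-\nabla_{[X,Y]}$ and their covariant derivatives of all orders. When $J$ is abelian, $\mathfrak z$ is $J$-invariant, hence even-dimensional. Choose an orthonormal basis $\{e_1,\dots,e_{2n}\}$ of $\mathfrak g$ with $Je_{2i-1}=-e_{2i}$ such that $e_{2(n-k)+1},\dots,e_{2n}$ span $\mathfrak z$. In this basis $\mathfrak{su}(n)\subseteq\mathfrak{so}(2n)$ denotes the skew-symmetric matrices $M=(m_{ij})$ commuting with $J$ and with $\sum_{i=1}^n m_{2i-1,2i}=0$, and $\mathfrak{su}(n-k)\subseteq\mathfrak{su}(n)$ denotes those whose last $2k$ rows and last $2k$ columns vanish. *)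

(* Defs.v *)
From HB Require Import structures.
From mathcomp Require Import all_boot all_order perm all_algebra.
From mathcomp Require Import reals.

Set Implicit Arguments.
Unset Strict Implicit.
Unset Printing Implicit Defensive.

Import Order.TTheory GRing.Theory Num.Theory.
Local Open Scope ring_scope.

Section LieAlgebra.
Variables (R : realType) (g : vectType R).

(* The bracket is stored as its adjoint map, so that it is bilinear by typing:
   [x, y] is [br x y], and [br x : 'End(g)] is ad_x. *)
Record lie_bracket := LieBracket {
  lie_ad :> 'Hom(g, 'End(g));
  lie_alternating : forall x, lie_ad x x = 0;
  lie_jacobi : forall x y z,
    lie_ad x (lie_ad y z) + lie_ad y (lie_ad z x) + lie_ad z (lie_ad x y) = 0 }.

(* Column convention: f e_j = \sum_i (endmx e f i j) e_i when e is a basis. *)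
Definition endmx m (e : m.-tuple g) (f : 'End(g)) : 'M[R]_m :=
  \matrix_(i, j) coord e i (f e`_j).

Definition center (br : lie_bracket) : {vspace g} := lker (lie_ad br).

Definition unimodular (br : lie_bracket) : Prop :=
  forall x, \tr (endmx (vbasis {:g}) (br x)) = 0.

(* A p-form is represented by its values on p-tuples of vectors; the forms used
   below are all built from the alternating form F by wedge products and d. *)
Definition form p := ('I_p -> g) -> R.

(* (a /\ b)(X_1, .., X_(p+q)) = 1/(p! q!)
     \sum_s sgn(s) a(X_s(1), .., X_s(p)) b(X_s(p+1), .., X_s(p+q)) *)
Definition wedge p q (a : form p) (b : form q) : form (p + q) :=
  fun X => (p`! * q`!)%:R^-1 * \sum_(s : 'S_(p + q)) (-1) ^+ s *
    (a (fun i => X (s (lshift q i))) * b (fun j => X (s (rshift p j)))).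

Fixpoint wedge_pow p (a : form p) (m : nat) : form (m * p) :=
  match m return form (m * p) with
  | 0 => fun _ => 1
  | m'.+1 => wedge a (@wedge_pow p a m')
  end.

Arguments wedge_pow {p} a m _.

(* da(X_0, .., X_p) = \sum_(i < j) (-1)^(i+j)
     a([X_i, X_j], X_0, .., omit X_i, .., omit X_j, .., X_p) *)
Definition ce_diff (br : lie_bracket) p (a : form p) : form p.+1 :=
  fun X => \sum_(i < p.+1) \sum_(j < p.+1 | (i < j)%N) (-1) ^+ (i + j) *
    a (fun l : 'I_p =>
         (br (X i) (X j)
            :: [seq X m | m <- enum 'I_p.+1 & (m != i) && (m != j)])`_l).

Definition is_complex_structure (br : lie_bracket) (J : 'End(g)) : Prop :=
  (forall x, J (J x) = - x) /\
  (forall x y, br (J x) (J y) - J (br (J x) y) - J (br x (J y)) - br x y = 0).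

Definition is_abelian_structure (br : lie_bracket) (J : 'End(g)) : Prop :=
  forall x y, br (J x) (J y) = br x y.

Definition is_hermitian (br : lie_bracket) (ip : {dot g for idfun})
    (J : 'End(g)) : Prop :=
  is_complex_structure br J /\ forall x y, ip (J x) (J y) = ip x y.

Definition fundamental_form (ip : {dot g for idfun}) (J : 'End(g)) : form 2 :=
  fun X => ip (X ord0) (J (X ord_max)).

(* n is half the dimension of g *)
Definition is_balanced (n : nat) (br : lie_bracket) (ip : {dot g for idfun})
    (J : 'End(g)) : Prop :=
  forall X, ce_diff br (wedge_pow (fundamental_form ip J) n.-1) X = 0.

Definition is_levi_civita (br : lie_bracket) (ip : {dot g for idfun})
    (D : 'Hom(g, 'End(g))) : Prop :=
  forall x y z,
    2 * ip (D x y) z = ip (br x y) z - ip (br y z) x + ip (br z x) y.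

Definition bismut_torsion (br : lie_bracket) (ip : {dot g for idfun})
    (J : 'End(g)) (x y z : g) : R :=
  - ce_diff br (fundamental_form ip J) (fun i => [:: J x; J y; J z]`_i).

(* As ip is nondegenerate, these equations determine the connections uniquely. *)
Definition is_bismut (br : lie_bracket) (ip : {dot g for idfun}) (J : 'End(g))
    (nabla : 'Hom(g, 'End(g))) : Prop :=
  exists2 D : 'Hom(g, 'End(g)), is_levi_civita br ip D &
    forall x y z,
      ip (nabla x y) z = ip (D x y) z + 2^-1 * bismut_torsion br ip J x y z.

Definition end_comm (f h : 'End(g)) : 'End(g) := (f \o h)%VF - (h \o f)%VF.

Definition curvature (br : lie_bracket) (nabla : 'Hom(g, 'End(g))) (x y : g) :
    'End(g) :=
  end_comm (nabla x) (nabla y) - nabla (br x y).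

Definition end_tensor p := ('I_p -> g) -> 'End(g).

(* (nabla S)(X_0, X_1, .., X_p) = [nabla_X_0, S(X_1, .., X_p)]
     - \sum_i S(X_1, .., nabla_X_0 X_i, .., X_p) *)
Definition cov_deriv (nabla : 'Hom(g, 'End(g))) p (S : end_tensor p) :
    end_tensor p.+1 :=
  fun X =>
    let X0 := X ord0 in let Y := fun i : 'I_p => X (lift ord0 i) in
    end_comm (nabla X0) (S Y)
    - \sum_(i < p) S (fun j => if j == i then nabla X0 (Y j) else Y j).

Fixpoint cov_deriv_curvature (br : lie_bracket) (nabla : 'Hom(g, 'End(g)))
    (r : nat) : end_tensor (r + 2) :=
  match r return end_tensor (r + 2) with
  | 0 => fun X => curvature br nabla (X ord0) (X ord_max)
  | r'.+1 => cov_deriv nabla (@cov_deriv_curvature br nabla r')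
  end.

Arguments cov_deriv_curvature br nabla r _ : clear implicits.

Inductive lie_generated (S : 'End(g) -> Prop) : 'End(g) -> Prop :=
| lie_generated_mem f : S f -> lie_generated S f
| lie_generated_zero : lie_generated S 0
| lie_generated_lin a f h :
    lie_generated S f -> lie_generated S h -> lie_generated S (a *: f + h)
| lie_generated_comm f h :
    lie_generated S f -> lie_generated S h -> lie_generated S (end_comm f h).

(* Holonomy algebra of a left-invariant connection, in the form given by the
   Ambrose-Singer theorem. *)
Definition hol (br : lie_bracket) (nabla : 'Hom(g, 'End(g))) : 'End(g) -> Prop :=
  lie_generated (fun f => exists r (X : 'I_(r + 2) -> g),
                   f = cov_deriv_curvature br nabla r X).

(* With 0-based indices: J e_(2i) = - e_(2i+1), and the last 2k vectors
   span the center. *)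
Definition is_adapted_basis (n k : nat) (br : lie_bracket)
    (ip : {dot g for idfun}) (J : 'End(g)) (e : n.*2.-tuple g) : Prop :=
  [/\ basis_of {:g} e,
      forall i j : 'I_n.*2, ip e`_i e`_j = (i == j)%:R,
      forall i : 'I_n, J e`_(i.*2) = - e`_(i.*2.+1) &
      <<drop (n - k).*2 e>>%VS = center br].

End LieAlgebra.

Section SpecialUnitary.
Variables (R : realType) (n : nat).

Definition dbl_ord (i : 'I_n) : 'I_n.*2 :=
  Ordinal (etrans (ltn_double i n) (ltn_ord i)).
Definition dblS_ord (i : 'I_n) : 'I_n.*2 :=
  Ordinal (etrans (ltn_Sdouble i n) (ltn_ord i)).

(* Jm is the matrix of J in an adapted basis. *)
Definition in_su (Jm M : 'M[R]_n.*2) : Prop :=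
  [/\ M^T = - M, M *m Jm = Jm *m M &
      \sum_(i < n) M (dbl_ord i) (dblS_ord i) = 0].

(* su(n - k) inside su(n): the last 2k rows and columns vanish. *)
Definition in_su_sub (k : nat) (Jm M : 'M[R]_n.*2) : Prop :=
  in_su Jm M /\
  forall i j : 'I_n.*2,
    ((n - k).*2 <= i)%N || ((n - k).*2 <= j)%N -> M i j = 0.

End SpecialUnitary.

(* Main.v *)
Require Import Defs.
From mathcomp Require Import all_boot all_order all_algebra.
From mathcomp Require Import reals.
From mathcomp Require Import all_fingroup boolp zify ring.
Set Implicit Arguments.
Unset Strict Implicit.
Unset Printing Implicit Defensive.
Import Order.TTheory GRing.Theory Num.Theory.
Local Open Scope ring_scope.

(** The proof rests on a closed formula for the Bismut connection.  When [J] is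
    abelian, the torsion [T(x, y, z) = - dF(Jx, Jy, Jz)] equals
    [- <[x,y],z> - <[y,z],x> - <[z,x],y>], and adding half of it to the Koszul
    formula leaves only [<nabla_x y, z> = - <x, [y,z]>] ([bismutE]).  From this
    formula, [nabla_x] is skew, it kills the center, and it commutes with [J]
    because [[Jy,z] = - [y,Jz]].  Moreover
    [tr (J nabla_x) = <x, \sum_i [e_i, J e_i]>].

    The vector [\sum_i [e_i, J e_i]] vanishes by the balanced condition
    ([balanced_sum]).  Write [w = F^(n-1)], a closed form of degree [2n - 2].
    For a linear form [u], unimodularity makes [d] vanish on forms of degree
    [2n - 1], so [0 = d(u /\ w) = du /\ w], i.e. the wedge of
    [(x, y) |-> u [x,y]] with [w] is zero ([wedge_closed_unimodular]).  On the
    other hand, wedging a 2-form with [F^(n-1)] takes its trace against [F]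
    ([wedge_wedge_pow]), which here gives a nonzero multiple of
    [u (\sum_i [e_i, J e_i])].

    Hence every [nabla_x] lies in [su(n-k)].  This is a Lie algebra, so it
    contains the curvature, all its covariant derivatives, which are built from
    the [nabla_x] by brackets and linear combinations, and finally the Lie
    algebra that these generate ([hol_su]).

    To avoid the exterior algebra, [du /\ w = 0] is derived from the action
    [form_act A] of an endomorphism [A] on forms as a derivation.  It acts on
    forms of top degree through the trace of [A], it obeys the Leibniz rule for
    wedge products, and [d] is a signed sum of the actions of the [ad_X]
    ([ce_diff_act]). *)

(** * Functions that are linear, and sums over ordinals *)

Section Scalar.
Variables (R : pzRingType) (U : lmodType R) (u : U -> R).
Hypothesis uL : scalar u.

Lemma scalar0 : u 0 = 0.
Proof. by have := uL (-1) 0 0; rewrite scaler0 addr0 mulN1r addNr. Qed.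

Lemma scalarN x : u (- x) = - u x.
Proof. by rewrite -scaleN1r -[_ *: _]addr0 uL scalar0 addr0 mulN1r. Qed.

Lemma scalar_sum I (r : seq I) (c : I -> R) (v : I -> U) :
  u (\sum_(i <- r) c i *: v i) = \sum_(i <- r) c i * u (v i).
Proof.
elim: r => [|i r IHr]; last by rewrite !big_cons uL IHr.
by rewrite !big_nil scalar0.
Qed.

End Scalar.

Lemma ord2P (i : 'I_2) : i = ord0 \/ i = ord_max.
Proof. by case: i => -[|[|//]] ?; [left|right]; apply: val_inj. Qed.

Lemma sum_lift_perm (V : nmodType) p (i0 : 'I_p.+1) (f : 'S_p.+1 -> V) :
  \sum_(s : 'S_p.+1) f s = \sum_(j < p.+1) \sum_(t : 'S_p) f (lift_perm i0 j t).
Proof.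
rewrite pair_big /= (reindex (fun x : 'I_p.+1 * 'S_p => lift_perm i0 x.1 x.2)) //.
apply/onW_bij/inj_card_bij; last first.
  by rewrite card_prod card_ord -!cardsT !cardsT !card_Sn factS.
move=> [j t] [j' t'] /= /permP eq_jt.
have ej : j = j' by have := eq_jt i0; rewrite !lift_perm_id.
rewrite -{}ej in eq_jt *; congr (_, _); apply/permP => k.
by have := eq_jt (lift i0 k); rewrite !lift_perm_lift => /lift_inj.
Qed.

Lemma sum_dbl_ord (V : nmodType) n (f : 'I_n.*2 -> V) :
  \sum_(i < n.*2) f i = \sum_(h < n) (f (dbl_ord h) + f (dblS_ord h)).
Proof.
elim: n f => [|n IHn] f; first by rewrite !big_ord0.
rewrite [RHS]big_ord_recr /= -[n.+1.*2]/(n.*2.+2) !big_ord_recr /= IHn -addrA.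
congr (_ + (_ + _)); last 2 first.
- by congr (f _); apply: val_inj.
- by congr (f _); apply: val_inj.
by apply: eq_bigr => h _; congr (f _ + f _); apply: val_inj.
Qed.

Lemma filter_neq_enum_ord p (i : 'I_p.+1) :
  [seq m <- enum 'I_p.+1 | m != i] = [seq lift i x | x <- enum 'I_p].
Proof.
have sorted_enum r : sorted (relpre val ltn) (enum 'I_r).
  by rewrite -sorted_map val_enum_ord iota_ltn_sorted.
apply: (@irr_sorted_eq _ (relpre val ltn)).
- by move=> x y z; apply: ltn_trans.
- by move=> x /=; rewrite ltnn.
- by apply: sorted_filter (sorted_enum _) => x y z; apply: ltn_trans.
- rewrite sorted_map; apply: sub_sorted (sorted_enum p) => x y /=.
  by rewrite !ltnNge leq_bump2.
move=> m; rewrite mem_filter mem_enum andbT.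
apply/idP/mapP => [|[x _ ->]]; last by rewrite eq_sym neq_lift.
case: (unliftP i m) => [x -> _|->]; last by rewrite eqxx.
by exists x; rewrite ?mem_enum.
Qed.

Lemma filter_neq2_enum_ord p (i : 'I_p.+2) (l : 'I_p.+1) :
  [seq m <- enum 'I_p.+2 | (m != i) && (m != lift i l)]
    = [seq lift i (lift l x) | x <- enum 'I_p].
Proof.
rewrite (eq_filter (a2 := predI (fun m => m != lift i l) (fun m => m != i))).
  rewrite filter_predI filter_neq_enum_ord filter_map.
  rewrite (eq_filter (a2 := fun m => m != l)).
    by rewrite filter_neq_enum_ord -map_comp.
  by move=> m /=; rewrite (inj_eq lift_inj).
by move=> m /=; rewrite andbC.
Qed.

(** * Alternating multilinear forms *)

Section Forms.
Variables (R : realType) (g : vectType R).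
Implicit Types (p q : nat) (A : 'End(g)).

Definition upd p (X : 'I_p -> g) (l : 'I_p) (v : g) : 'I_p -> g :=
  fun i => if i == l then v else X i.

Definition alternating p (w : Defs.form g p) :=
  forall (s : 'S_p) X, w (X \o s) = (-1) ^+ s * w X.

Definition multilinear p (w : Defs.form g p) :=
  forall X l, scalar (fun v => w (upd X l v)).

(** The derivation action of [gl(g)] on forms, up to sign: for [A = ad_x] it is
    minus the Lie derivative along [x]. *)
Definition form_act A p (w : Defs.form g p) : Defs.form g p :=
  fun X => \sum_l w (upd X l (A (X l))).

Lemma upd_comp p q (f : 'I_q -> 'I_p) (X : 'I_p -> g) l v :
  injective f -> upd X (f l) v \o f = upd (X \o f) l v.
Proof. by move=> inj_f; apply/funext => i; rewrite /upd /= (inj_eq inj_f). Qed.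

Lemma upd_comp_out p q (f : 'I_q -> 'I_p) (X : 'I_p -> g) l v :
  (forall i, f i != l) -> upd X l v \o f = X \o f.
Proof.
by move=> nfl; apply/funext => i; rewrite /upd /= (negPf (nfl i)).
Qed.

Lemma wedgeE p q (a : Defs.form g p) (b : Defs.form g q) X :
  wedge a b X = (p`! * q`!)%:R^-1 * \sum_(s : 'S_(p + q)) (-1) ^+ s *
    (a (X \o s \o lshift q) * b (X \o s \o @rshift p q)).
Proof. by []. Qed.

(** The sum over permutations antisymmetrizes, so that the factors themselves
    may be arbitrary. *)
Lemma wedge_alternating p q (a : Defs.form g p) (b : Defs.form g q) :
  alternating (wedge a b).
Proof.
move=> s X; rewrite /wedge mulrCA; congr (_ * _).
rewrite mulr_sumr [RHS](reindex_inj (mulIg s)) /=.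
apply: eq_bigr => t _; rewrite [RHS]mulrA; congr (_ * _).
  by rewrite odd_permM signr_addb mulrCA -signr_addb addbb mulr1.
by congr (a _ * b _); apply/funext => i; rewrite permM.
Qed.

Lemma wedge_multilinear p q (a : Defs.form g p) (b : Defs.form g q) :
  multilinear a -> multilinear b -> multilinear (wedge a b).
Proof.
move=> aL bL X l c u v; rewrite !wedgeE [c * _]mulrCA -mulrDr; congr (_ * _).
rewrite mulr_sumr -big_split /=; apply: eq_bigr => s _.
rewrite [c * _]mulrCA -mulrDr; congr (_ * _).
have sl : l = s (s^-1%g l) by rewrite permKV.
set k := s^-1%g l in sl; rewrite sl !(upd_comp _ _ _ (@perm_inj _ s)).
case: (splitP k) => [k' ek|k' ek].
  have -> : k = lshift q k' by exact: val_inj.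
  rewrite !(upd_comp _ _ _ (@lshift_inj _ _)) aL mulrDl mulrA.
  by rewrite !upd_comp_out // => i; rewrite eq_rlshift.
have -> : k = rshift p k' by exact: val_inj.
rewrite !(upd_comp _ _ _ (@rshift_inj _ _)) bL mulrDr mulrCA.
by rewrite !upd_comp_out // => i; rewrite eq_lrshift.
Qed.

Lemma form_act_alternating A p (w : Defs.form g p) :
  alternating w -> alternating (form_act A w).
Proof.
move=> wA s X; rewrite /form_act [in RHS](reindex_inj (@perm_inj _ s)) mulr_sumr.
by apply: eq_bigr => l _; rewrite -wA upd_comp //; exact: perm_inj.
Qed.

(** Leibniz rule: after a permutation of the arguments, the slot on which [A]
    acts belongs either to the first factor or to the second one. *)
Lemma form_act_wedge A p q (a : Defs.form g p) (b : Defs.form g q) X :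
  form_act A (wedge a b) X
    = wedge (form_act A a) b X + wedge a (form_act A b) X.
Proof.
transitivity ((p`! * q`!)%:R^-1 * \sum_(s : 'S_(p + q)) (-1) ^+ s *
    \sum_(k < p + q) (a (upd (X \o s) k (A (X (s k))) \o lshift q)
                    * b (upd (X \o s) k (A (X (s k))) \o @rshift p q))).
  rewrite /form_act -mulr_sumr exchange_big /=; congr (_ * _).
  apply: eq_bigr => s _; rewrite mulr_sumr [LHS](reindex_inj (@perm_inj _ s)).
  by apply: eq_bigr => k _; rewrite -upd_comp //; exact: perm_inj.
rewrite !wedgeE -mulrDr -big_split /=; congr (_ * _).
apply: eq_bigr => s _; rewrite -mulrDr; congr (_ * _).
rewrite big_split_ord /= mulr_suml mulr_sumr.
congr (_ + _); apply: eq_bigr => k _.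
  rewrite (upd_comp _ _ _ (@lshift_inj _ _)) upd_comp_out // => i.
  by rewrite eq_rlshift.
rewrite (upd_comp _ _ _ (@rshift_inj _ _)) upd_comp_out // => i.
by rewrite eq_lrshift.
Qed.

Lemma alternating_eq0 p (w : Defs.form g p) X i j :
  alternating w -> i != j -> X i = X j -> w X = 0.
Proof.
move=> wA nij eX; have := wA (tperm i j) X.
rewrite odd_tperm nij expr1 mulN1r => wN.
have : w X = - w X.
  rewrite -{}wN; congr (w _); apply/funext => k /=.
  by case: tpermP => // ->.
by move/eqP; rewrite -subr_eq0 opprK -mulr2n mulrn_eq0 => /eqP.
Qed.

(** If [A (E l)] is expanded in the basis [E], then only its component along
    [E l] contributes, since any other one repeats a vector. *)
Lemma form_act_top p (w : Defs.form g p) A (E : 'I_p -> g) (c : 'I_p -> g -> R) :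
  alternating w -> multilinear w ->
  (forall x, x = \sum_i c i x *: E i) ->
  form_act A w E = (\sum_i c i (A (E i))) * w E.
Proof.
move=> wA wL cE; rewrite /form_act mulr_suml; apply: eq_bigr => l _.
rewrite {1}[A (E l)]cE (scalar_sum (wL E l)) (bigD1 l) //= big1 ?addr0.
  by congr (_ * w _); apply/funext => i; rewrite /upd; case: eqP => [->|].
move=> i nil; rewrite (@alternating_eq0 _ _ _ i l) ?mulr0 //.
by rewrite /upd eqxx (negPf nil).
Qed.

(** Laplace expansion: permutations are grouped by their first two values [i]
    and [lift i l]; the [p!] permutations of each group contribute equally
    because [w] is alternating. *)
Lemma wedge2_laplace p (a : Defs.form g 2) (w : Defs.form g p) (X : 'I_p.+2 -> g) :
  alternating w ->
  wedge a w X = 2^-1 * \sum_(i < p.+2) \sum_(l < p.+1) (-1) ^+ (i + l) *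
    (a (fun k => [:: X i; X (lift i l)]`_k) * w (X \o lift i \o lift l)).
Proof.
move=> wA; rewrite wedgeE natrM invfM -mulrA; congr (_ * _).
apply: (canLR (mulKf _)); first by rewrite pnatr_eq0 -lt0n fact_gt0.
rewrite mulr_sumr (sum_lift_perm ord0); apply: eq_bigr => i _.
rewrite mulr_sumr (sum_lift_perm ord0); apply: eq_bigr => l _.
rewrite -card_Sn -sum1_card natr_sum mulr_suml.
apply: eq_bigr => t _; rewrite mul1r !odd_lift_perm /= 2!signr_addb.
set s := lift_perm _ _ _.
have -> : (X \o s : 'I_(2 + p) -> g) \o @lshift 2 p
        = fun k => [:: X i; X (lift i l)]`_k.
  apply/funext => k /=; case: (ord2P k) => ->.
    have -> : lshift p (ord0 : 'I_2) = ord0 by exact: val_inj.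
    by rewrite lift_perm_id.
  have -> : lshift p (ord_max : 'I_2) = lift ord0 ord0 by exact: val_inj.
  by rewrite lift_perm_lift lift_perm_id.
have -> : (X \o s : 'I_(2 + p) -> g) \o @rshift 2 p = X \o lift i \o lift l \o t.
  apply/funext => k /=.
  have -> : rshift 2 k = lift ord0 (lift ord0 k) by exact: val_inj.
  by rewrite !lift_perm_lift.
rewrite wA exprD -(signr_odd _ i) -(signr_odd _ l).
have tK : (-1) ^+ t * (-1) ^+ t = 1 :> R by rewrite -signr_addb addbb.
rewrite [in LHS]mulrA [X in _ * X = _]mulrCA -[LHS]mulrA.
by rewrite [X in _ * X = _]mulrA tK mul1r.
Qed.

End Forms.

(** * The Chevalley-Eilenberg differential *)

Section Differential.
Variables (R : realType) (g : vectType R) (br : lie_bracket g).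

Lemma lie_antisym x y : br x y = - br y x.
Proof.
apply/eqP; rewrite -addr_eq0; apply/eqP.
have := lie_alternating br (x + y).
have addbr u : br (x + y) u = br x u + br y u by rewrite linearD add_lfunE.
by rewrite addbr !linearD /= !lie_alternating add0r addr0.
Qed.

(** Moving the slot [l] to the front is the cycle [lift_perm ord0 l 1], whose
    sign is [(-1)^l]. *)
Lemma nth_cons_lift2 p (v : g) (X : 'I_p.+2 -> g) i l (k : 'I_p.+1) :
  (v :: [seq X m | m <- enum 'I_p.+2 & (m != i) && (m != lift i l)])`_k
    = (upd (X \o lift i) l v) (lift_perm ord0 l 1 k).
Proof.
rewrite filter_neq2_enum_ord -map_comp /upd.
case: (unliftP ord0 k) => [x ->|->] /=; last by rewrite lift_perm_id eqxx.
rewrite lift_perm_lift perm1 eq_sym (negPf (neq_lift _ _)).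
rewrite (nth_map x) ?size_enum_ord ?ltn_ord //=.
by congr (X (lift i (lift l _))); apply: nth_ord_enum.
Qed.

(** Each unordered pair of arguments occurs twice on the left-hand side, with
    equal contributions since both the bracket and the sign change. *)
Lemma ce_diff_act p (w : Defs.form g p) (X : 'I_p.+1 -> g) :
  alternating w -> multilinear w ->
  \sum_(i < p.+1) (-1) ^+ i * form_act (br (X i)) w (X \o lift i)
    = - 2 * ce_diff br w X.
Proof.
case: p w X => [|p] w X wA wL.
  rewrite /ce_diff !big_ord1 /form_act big_ord0 mulr0 ?big1 ?mulr0 //.
  by move=> -[[]].
pose G i j := w (fun k : 'I_p.+1 =>
  (br (X i) (X j) :: [seq X m | m <- enum 'I_p.+2 & (m != i) && (m != j)])`_k).
have GC i j : G j i = - G i j.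
  rewrite /G; set r := (X in _ :: X).
  set r' := (X in w _ = - w (fun k => (_ :: X)`_k)).
  have <- : r = r' by congr (map _ _); apply: eq_filter => m; rewrite andbC.
  pose Y k := (0 :: r)`_(k : 'I_p.+1).
  have Yu v : (fun k : 'I_p.+1 => (v :: r)`_k) = upd Y ord0 v.
    apply/funext => k; rewrite /upd /Y; case: (unliftP ord0 k) => [x|] -> //=.
  by rewrite !Yu lie_antisym (scalarN (wL Y ord0)).
pose K (i j : 'I_p.+2) := if (i < j)%N then - ((-1) ^+ (i + j) * G i j) else 0.
have actE (i : 'I_p.+2) : (-1) ^+ i * form_act (br (X i)) w (X \o lift i)
    = \sum_j (K i j + K j i).
  rewrite [RHS](bigD1_ord i) //= /K ltnn addr0 add0r /form_act mulr_sumr.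
  apply: eq_bigr => l _ /=.
  have -> : w (upd (X \o lift i) l (br (X i) (X (lift i l))))
      = (-1) ^+ l * G i (lift i l).
    rewrite /G (funext (nth_cons_lift2 (br (X i) (X (lift i l))) X i l)).
    by rewrite wA odd_lift_perm odd_perm1 addbF /= signr_odd signrMK.
  rewrite mulrA -exprD; case: (ltnP l i) => li.
    have -> : bump i l = l by rewrite /bump leqNgt li.
    by rewrite li ltnNge (ltnW li) add0r (GC i) mulrN opprK addnC.
  have -> : bump i l = l.+1 by rewrite /bump li.
  by rewrite ltnS li ltnNge (leqW li) addr0 addnS exprS mulN1r mulNr opprK.
under eq_bigr do rewrite actE big_split /=.
rewrite big_split /= [X in _ + X]exchange_big /= -mulr2n mulNr mulr_natl -mulNrn.
congr (_ *+ 2); rewrite /ce_diff -sumrN; apply: eq_bigr => i _.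
by rewrite -sumrN [RHS]big_mkcond.
Qed.

Lemma ce_diff2 (a : Defs.form g 2) (x y z : g) :
  ce_diff br a (fun i => [:: x; y; z]`_i)
   = - a (fun k => [:: br x y; z]`_k) + a (fun k => [:: br x z; y]`_k)
     - a (fun k => [:: br y z; x]`_k).
Proof.
rewrite /ce_diff.
have enum3 : enum 'I_3 = [:: ord0; lift ord0 ord0; lift ord0 (lift ord0 ord0)].
  by apply: (inj_map val_inj); rewrite val_enum_ord.
under eq_bigr do rewrite big_mkcond /= !big_ord_recl big_ord0 /= enum3 /=.
rewrite !big_ord_recl big_ord0 /=.
rewrite /bump /= !addn0 !add0n !addr0 !add0r !add1n !expr2 !expr1.
by rewrite -[_ ^+ 3]signr_odd expr1 mulrNN mulr1 !mulN1r mul1r.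
Qed.

(** This is [du /\ w = 0] for a closed form [w] of codegree 2.  The forms
    [u /\ c_l /\ w] have top degree, so each [ad_(E l)] kills them by
    unimodularity.  Expand this by the Leibniz rule and sum over [l].  The terms
    where [ad_(E l)] acts on [u] or [c_l] add up to a multiple of [du /\ w] plus
    a term with the factor [tr ad], which is zero; those where it acts on [w]
    add up to a multiple of [u /\ dw]. *)
Lemma wedge_closed_unimodular p (w : Defs.form g p) (E : 'I_p.+2 -> g)
    (c : 'I_p.+2 -> g -> R) (u : g -> R) :
  alternating w -> multilinear w -> (forall X, ce_diff br w X = 0) ->
  scalar u -> (forall i, scalar (c i)) ->
  (forall x, x = \sum_i c i x *: E i) -> (forall i j, c i (E j) = (i == j)%:R) ->
  (forall x, \sum_i c i (br x (E i)) = 0) ->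
  wedge (fun Z : 'I_2 -> g => u (br (Z ord0) (Z ord_max))) w E = 0.
Proof.
move=> wA wL dw0 uL cL cE cd tr0.
pose a l : Defs.form g 2 := fun Z => u (Z ord0) * c l (Z ord_max).
have aL l : multilinear (a l).
  move=> X k b x y; rewrite /a /upd; case: (ord2P k) => -> /=.
    by rewrite uL mulrDl mulrA.
  by rewrite cL mulrDr mulrCA.
have act0 l : wedge (form_act (br (E l)) (a l)) w E
    = - wedge (a l) (form_act (br (E l)) w) E.
  apply/eqP; rewrite -addr_eq0 -form_act_wedge.
  rewrite (form_act_top (w := wedge (a l) w) _ _ _ cE) ?tr0 ?mul0r //.
    exact: wedge_alternating.
  exact: wedge_multilinear.
have sum_a X : \sum_l form_act (br (E l)) (a l) X = - u (br (X ord0) (X ord_max)).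
  have actE l : form_act (br (E l)) (a l) X
      = c l (X ord_max) * u (br (E l) (X ord0))
        - u (X ord0) * c l (br (X ord_max) (E l)).
    rewrite /form_act big_ord_recl big_ord1 /a /upd /= mulrC; congr (_ + _).
    have -> : lift ord0 ord0 = ord_max :> 'I_2 by exact: val_inj.
    by rewrite [in LHS]lie_antisym (scalarN (cL l)) mulrN.
  under eq_bigr do rewrite actE.
  rewrite sumrB -mulr_sumr tr0 mulr0 subr0.
  have bL : scalar (fun y => u (br y (X ord0))).
    by move=> b x y; rewrite linearP add_lfunE scale_lfunE uL.
  by rewrite -(scalar_sum bL) -cE lie_antisym (scalarN uL).
have -> : wedge (fun Z : 'I_2 -> g => u (br (Z ord0) (Z ord_max))) w E
    = - \sum_l wedge (form_act (br (E l)) (a l)) w E.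
  rewrite wedgeE -[RHS]/(- \sum_l (_ * \sum_s _)) -mulr_sumr exchange_big -mulrN /=.
  congr (_ * _); rewrite -sumrN; apply: eq_bigr => s _.
  by rewrite -mulr_sumr -mulr_suml sum_a -mulrN mulNr opprK.
rewrite (eq_bigr _ (fun l _ => act0 l)) sumrN opprK.
rewrite (eq_bigr _ (fun l _ => wedge2_laplace (a l) E
  (form_act_alternating (br (E l)) wA))).
rewrite -mulr_sumr exchange_big big1 ?mulr0 // => i _ /=.
rewrite exchange_big /=.
transitivity ((-1) ^+ i * u (E i) * \sum_(k < p.+1) (-1) ^+ k *
   form_act (br (E (lift i k))) w (E \o lift i \o lift k)); last first.
  by rewrite (ce_diff_act (E \o lift i) wA wL) dw0 !mulr0.
rewrite mulr_sumr; apply: eq_bigr => k _.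
(* The Kronecker delta in c_l (E (lift i k)) selects l = lift i k. *)
rewrite (bigD1 (lift i k)) //= big1 => [|l /negPf nl].
  rewrite /a /= cd eqxx mulr1 addr0 exprD !mulrA; congr (_ * _).
  by rewrite -!mulrA; congr (_ * _); rewrite mulrC.
by rewrite /a /= cd nl mulr0 mul0r mulr0.
Qed.

End Differential.

(** * Powers of a symplectic form *)

Section WedgePow.
Variables (R : realType) (g : vectType R).

Lemma wedge_pow_alternating p (a : Defs.form g p) m :
  alternating (@wedge_pow _ _ _ a m).
Proof.
case: m => [|m]; last exact: wedge_alternating.
move=> s X /=; have -> : s = 1%g by apply/permP => -[].
by rewrite odd_perm1 mul1r.
Qed.

Lemma wedge_pow_multilinear p (a : Defs.form g p) m :
  multilinear a -> multilinear (@wedge_pow _ _ _ a m).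
Proof.
move=> aL; elim: m => [|m IHm]; last exact: wedge_multilinear.
by move=> X [].
Qed.

(** Every term in the expansion of the power has a factor [a] with [Y l] among
    its arguments. *)
Lemma wedge_pow_null p (a : Defs.form g p) m (Y : 'I_(m * p) -> g) l :
  (forall (f : 'I_p -> 'I_(m * p)) k, f k = l -> a (Y \o f) = 0) ->
  @wedge_pow _ _ _ a m Y = 0.
Proof.
elim: m Y l => [|m IHm] Y l aY0; first by case: l aY0.
have -> : @wedge_pow _ _ _ a m.+1 Y = wedge a (@wedge_pow _ _ _ a m) Y by [].
rewrite wedgeE big1 ?mulr0 // => s _.
have sl : s (s^-1%g l) = l by rewrite permKV.
case: (splitP (s^-1%g l)) => [k ek|k ek].
  rewrite (aY0 (s \o @lshift p (m * p)) k) ?mul0r ?mulr0 //= -sl.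
  by congr (s _); apply: val_inj.
rewrite (IHm _ k) ?mulr0 // => f j fj.
rewrite (aY0 (s \o @rshift p (m * p) \o f) j) //= fj -sl.
by congr (s _); apply: val_inj.
Qed.

(** The involution [2h <-> 2h+1]. *)
Definition partner i := if odd i then i.-1 else i.+1.

(** The standard symplectic matrix, in blocks [0, 1; -1, 0]. *)
Definition omega i j : R := if j == partner i then (-1) ^+ i else 0.

Lemma partnerK : involutive partner.
Proof. by move=> i; rewrite /partner; case: (boolP (odd i)); case: ifP; lia. Qed.

Lemma partner_neq i : (i == partner i) = false.
Proof. by rewrite /partner; case: (boolP (odd i)); lia. Qed.

Lemma ltn_partner i m : (i < m * 2)%N -> (partner i < m * 2)%N.
Proof. by rewrite /partner; case: (boolP (odd i)); lia. Qed.

Lemma signr_partner i : (-1) ^+ partner i = - (-1) ^+ i :> R.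
Proof.
rewrite -signr_odd -[in RHS]signr_odd /partner.
by case: (boolP (odd i)) => oi; [case: i oi => //= i /negPf-> | rewrite /= oi];
  rewrite expr0 ?opprK.
Qed.

Lemma bump_partner_even i l : bump i l = partner i -> ~~ odd l.
Proof. by rewrite /bump /partner; case: (leqP i l); case: (boolP (odd i)); lia. Qed.

Lemma bump_bump_partner i l x : bump i l = partner i ->
  bump i (bump l x) = (if x < l then x else x.+2)%N.
Proof.
rewrite /bump /partner; case: (leqP i l); case: (boolP (odd i)) => oi il.
- lia.
- by case: (ltnP x l) => xl; rewrite /= ?add0n ?add1n; case: leqP; lia.
- by case: (ltnP x l) => xl; rewrite /= ?add0n ?add1n; case: leqP; lia.
- lia.
Qed.

(** Deleting a pair of partners shifts the later indices by 2, so that the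
    remaining pairs are still pairs and keep their signs. *)
Lemma omega_bump_bump i l x y : bump i l = partner i ->
  omega (bump i (bump l x)) (bump i (bump l y)) = omega x y.
Proof.
move=> il; have ol := bump_partner_even il; rewrite !(bump_bump_partner _ il).
rewrite /omega /partner -[in RHS]signr_odd -[in LHS]signr_odd.
case: (ltnP x l) => xl; case: (ltnP y l) => yl //=; rewrite ?negbK.
- by do 2 case: eqP => //; case: (boolP (odd x)); lia.
- by do 2 case: eqP => //; case: (boolP (odd x)); lia.
- by congr (if _ then _ else _); case: (boolP (odd x)); lia.
Qed.

Definition symplectic p (a : Defs.form g 2) (E : 'I_p -> g) :=
  forall f : 'I_2 -> 'I_p, a (E \o f) = omega (f ord0) (f ord_max).

Lemma symplecticE p (a : Defs.form g 2) (E : 'I_p -> g) i j :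
  symplectic a E -> a (fun k => [:: E i; E j]`_k) = omega i j.
Proof.
move=> aE; rewrite -(aE (fun k => if k == ord0 then i else j)).
by congr (a _); apply/funext => k; case: (ord2P k) => ->.
Qed.

Lemma symplectic_lift2 p a (E : 'I_p.+2 -> g) i l :
  symplectic a E -> nat_of_ord (lift i l) = partner i ->
  symplectic a (E \o lift i \o lift l).
Proof.
move=> aE il f; rewrite (aE (lift i \o lift l \o f)) /=.
exact: omega_bump_bump.
Qed.

(** In the Laplace expansion, removing from a symplectic basis two vectors that
    are not partners leaves one that is orthogonal to all the others, and kills
    the power of [a]; removing two partners leaves a symplectic basis again. *)
Lemma wedge_wedge_pow m (a b : Defs.form g 2) (E : 'I_(m * 2).+2 -> g) z :
  symplectic a E ->
  (forall E' : 'I_(m * 2) -> g, symplectic a E' -> @wedge_pow _ _ _ a m E' = z) ->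
  wedge b (@wedge_pow _ _ _ a m) E = 2^-1 * z *
    \sum_(i < (m * 2).+2) \sum_(j < (m * 2).+2)
      omega i j * b (fun k => [:: E i; E j]`_k).
Proof.
move=> aE az; rewrite wedge2_laplace; last exact: wedge_pow_alternating.
rewrite -[RHS]mulrA; congr (_ * _); rewrite mulr_sumr; apply: eq_bigr => i _.
rewrite (bigD1_ord i) //= mulrDr mulr_sumr.
rewrite {1}/omega [_ == _](_ : _ = false) ?mul0r ?mulr0 ?add0r; last first.
  exact: partner_neq.
apply: eq_bigr => l _; rewrite /omega.
have [il|nil] := eqVneq (bump i l) (partner i).
  have ol : ~~ odd l := bump_partner_even il.
  rewrite (az _ (symplectic_lift2 aE il)) exprD -(signr_odd _ l) (negPf ol) mulr1.
  by rewrite [RHS]mulrCA [z * _]mulrC.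
rewrite mul0r mulr0.
pose i' := Ordinal (@ltn_partner i m.+1 (ltn_ord i)).
case: (unliftP i i') => [k' ek|/(congr1 val) /= ei]; last first.
  by have := partner_neq i; rewrite ei eqxx.
case: (unliftP l k') => [y ey|el]; last first.
  by rewrite -[bump i l]/(val (lift i l)) -el -ek eqxx in nil.
(* y is the position of the partner of i, whose only partner i was removed. *)
rewrite (@wedge_pow_null _ a m _ y) ?mulr0 // => f k fk.
rewrite (aE (lift i \o lift l \o f)) /omega /=.
have fki : nat_of_ord (lift i (lift l (f k))) = partner i.
  by rewrite fk -ey -ek.
have fni k2 : nat_of_ord (lift i (lift l (f k2))) != i.
  by rewrite (inj_eq val_inj) eq_sym neq_lift.
case: eqP => // e01; exfalso.
case: (ord2P k) fki => -> /= fki.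
  by have := fni ord_max; rewrite /= e01 fki partnerK eqxx.
by have := fni ord0; rewrite /= -[X in X != _]partnerK -e01 fki partnerK eqxx.
Qed.

Lemma wedge_pow_symplectic m (a : Defs.form g 2) (E : 'I_(m * 2) -> g) :
  symplectic a E -> @wedge_pow _ _ _ a m E = m`!%:R.
Proof.
elim: m E => [|m IHm] E aE //.
have -> : @wedge_pow _ _ _ a m.+1 E = wedge a (@wedge_pow _ _ _ a m) E by [].
rewrite (wedge_wedge_pow _ aE IHm).
(* Each row of the symplectic matrix has a single nonzero entry, a sign. *)
rewrite (eq_bigr (fun=> 1)) => [|i _]; last first.
  rewrite (bigD1 (Ordinal (@ltn_partner i m.+1 (ltn_ord i)))) //= big1.
    rewrite (symplecticE _ _ aE) /= /omega /= eqxx addr0.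
    by rewrite -signr_odd -signr_addb addbb.
  move=> j /negPf nj; rewrite /omega.
  by rewrite -(inj_eq val_inj) /= in nj; rewrite nj mul0r.
rewrite sumr_const card_ord factS natrM -[((m * 2).+2)]/(m.+1 * 2)%N.
rewrite [(m.+1 * 2)%:R]natrM [2^-1 * _]mulrC -[LHS]mulrA [2^-1 * _]mulrCA.
by rewrite mulVf ?pnatr_eq0 // mulr1 mulrC.
Qed.

End WedgePow.

(** * Matrices of endomorphisms *)

Section Endmx.
Variables (R : realType) (g : vectType R).
Implicit Types f h : 'End(g).

Lemma mxtrace_endmx_basis m n (e : m.-tuple g) (e' : n.-tuple g) f :
  basis_of {:g} e -> basis_of {:g} e' -> \tr (endmx e f) = \tr (endmx e' f).
Proof.
move=> be be'; rewrite /mxtrace.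
under eq_bigr do rewrite mxE.
under [RHS]eq_bigr do rewrite mxE.
transitivity (\sum_(i < m) \sum_(j < n) coord e' j e`_i * coord e i (f e'`_j)).
  apply: eq_bigr => i _.
  rewrite {1}(coord_basis be' (memvf e`_i)) linear_sum linear_sum.
  by apply: eq_bigr => j _; rewrite !linearZ.
rewrite exchange_big /=; apply: eq_bigr => j _.
rewrite {2}(coord_basis be (memvf (f e'`_j))) linear_sum.
by apply: eq_bigr => i _; rewrite linearZ /= mulrC.
Qed.

Variables (m : nat) (e : m.-tuple g).

Lemma endmxD f h : endmx e (f + h) = endmx e f + endmx e h.
Proof. by apply/matrixP => i j; rewrite !mxE add_lfunE linearD. Qed.

Lemma endmxZ c f : endmx e (c *: f) = c *: endmx e f.
Proof. by apply/matrixP => i j; rewrite !mxE scale_lfunE linearZ. Qed.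

Lemma endmx0 : endmx e (0 : 'End(g)) = 0.
Proof. by apply/matrixP => i j; rewrite !mxE zero_lfunE linear0. Qed.

Lemma endmx_comp f h : basis_of {:g} e ->
  endmx e (f \o h)%VF = endmx e f *m endmx e h.
Proof.
move=> be; apply/matrixP => i j; rewrite !mxE comp_lfunE.
rewrite {1}(coord_basis be (memvf (h e`_j))) !linear_sum.
by apply: eq_bigr => l _; rewrite !mxE !linearZ mulrC.
Qed.

End Endmx.

(** * The Bismut connection of an abelian Hermitian structure *)

Section Hermitian.
Variables (R : realType) (g : vectType R) (ip : {dot g for idfun}).
Variables (br : lie_bracket g) (J : 'End(g)).
Hypothesis hherm : is_hermitian br ip J.

Lemma ipC x y : ip x y = ip y x.
Proof. by rewrite hermC expr0 mul1r. Qed.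

Lemma ip_scalar z : scalar (ip^~ z).
Proof. by move=> c x y; rewrite linearPl. Qed.

Lemma ip_eq0 x : (forall y, ip x y = 0) -> x = 0.
Proof.
move=> x0; apply/eqP; apply: contraT => /(neq0_dnorm_gt0 (s := ip)).
by rewrite x0 ltxx.
Qed.

Lemma herm_skew x y : ip (J x) y = - ip x (J y).
Proof. by case: hherm => [[J2 _] Jip]; rewrite -(Jip (J x) y) J2 linearNl. Qed.

Lemma fundamental_form_multilinear : multilinear (fundamental_form ip J).
Proof.
move=> X l c u v; rewrite /fundamental_form /upd; case: (ord2P l) => -> /=.
  by rewrite linearPl.
by rewrite linearP linearPr.
Qed.

(** Since [J] is abelian, the arguments [Jx, Jy, Jz] of [dF] in the torsion can
    be freed from [J], and half the torsion cancels all the terms of the Koszul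
    formula but one. *)
Lemma bismutE nabla x y z :
  is_abelian_structure br J -> is_bismut br ip J nabla ->
  ip (nabla x y) z = - ip x (br y z).
Proof.
move=> Jab [D HD Hn]; have [[J2 _] _] := hherm.
have J2r u v : ip u (J (J v)) = - ip u v by rewrite J2 linearNr.
have ipA u v w : ip (br u v) w = - ip (br v u) w by rewrite lie_antisym linearNl.
have := HD x y z.
rewrite Hn /bismut_torsion ce_diff2 /fundamental_form /= !Jab !J2r.
rewrite [ip (br z x) y]ipA [ip x _]ipC => HDxy.
apply: (@mulfI _ (2 : R)); first by rewrite pnatr_eq0.
rewrite mulrDr HDxy mulrA mulfV ?pnatr_eq0 // mul1r.
by move: (ip _ z) (ip _ y) (ip _ x) => p q r; ring.
Qed.

(** * Adapted bases and the balanced condition *)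

Variables (n k : nat) (e : n.*2.-tuple g).
Hypothesis he : is_adapted_basis k br ip J e.

Lemma adapted_basis : basis_of {:g} e.
Proof. by case: he. Qed.

Lemma adapted_ip (i j : nat) : (i < n.*2)%N -> (j < n.*2)%N ->
  ip e`_i e`_j = (i == j)%:R.
Proof. by case: he => _ eo _ _ li lj; rewrite (eo (Ordinal li) (Ordinal lj)). Qed.

Lemma adapted_coord i x : coord e i x = ip x e`_i.
Proof.
rewrite {2}(coord_basis adapted_basis (memvf x)) linear_sumlz.
rewrite (bigD1 i) //= big1 ?addr0 => [|j nj]; rewrite linearZl_LR /= adapted_ip //.
  by rewrite eqxx mulr1.
by rewrite (inj_eq val_inj) (negPf nj) mulr0.
Qed.

Lemma adapted_J (i : nat) : (i < n.*2)%N -> J e`_i = - (-1) ^+ i *: e`_(partner i).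
Proof.
case: he => _ _ eJ _ li; have [oi|oi] := boolP (odd i).
  have li2 : (i./2 < n)%N by lia.
  have /(congr1 J) := eJ (Ordinal li2).
  rewrite -signr_odd /partner oi expr1 opprK scale1r /= linearN /=.
  case: hherm => -[-> _] _ => /oppr_inj.
  have -> : (i./2.*2.+1 = i)%N by lia.
  by have -> : (i./2.*2 = i.-1)%N by lia.
have li2 : (i./2 < n)%N by lia.
have := eJ (Ordinal li2).
rewrite -signr_odd /partner (negPf oi) expr0 scaleN1r /=.
by have -> : (i./2.*2 = i)%N by lia.
Qed.

Lemma fundamental_form_symplectic p :
  p = n.*2 -> symplectic (fundamental_form ip J) (fun i : 'I_p => e`_i).
Proof.
move=> -> f; rewrite /fundamental_form /= adapted_J // linearZr_LR /=.
have ltp : (partner (f ord_max) < n.*2)%N by rewrite -[X in (_ < X)%N]muln2 ltn_partner ?muln2.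
rewrite adapted_ip // /omega.
have [->|nf] := eqVneq (f ord0 : nat) (partner (f ord_max)).
  by rewrite partnerK eqxx signr_partner mulr1.
case: eqP => [f1|_]; last by rewrite mulr0.
by rewrite f1 partnerK eqxx in nf.
Qed.

End Hermitian.

(** Up to a sign, the sum is the trace of the bracket against [F], hence what is
    left of [du /\ F^(n-1) = 0] for [u] the inner product with any vector [z]. *)
Lemma balanced_sum (R : realType) (g : vectType R) n k (br : lie_bracket g)
  (ip : {dot g for idfun}) (J : 'End(g)) (e : n.*2.-tuple g) :
  unimodular br -> is_hermitian br ip J -> is_balanced n br ip J ->
  is_adapted_basis k br ip J e ->
  \sum_(i < n.*2) br e`_i (J e`_i) = 0.
Proof.
move=> um hJ; case: n e => [|m] e bal he; first by rewrite big_ord0.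
(* The degree of F^m is m * 2, which does not reduce to m.*2. *)
have sumE (V : nmodType) (f : nat -> V) :
    \sum_(i < (m * 2).+2) f i = \sum_(i < m.+1.*2) f i.
  by rewrite -!(big_mkord xpredT f) -muln2.
have ltE i : (i < (m * 2).+2)%N -> (i < m.+1.*2)%N by rewrite -muln2.
pose E (i : 'I_(m * 2).+2) := e`_i; pose F := fundamental_form ip J.
have FE : symplectic F E.
  by apply: (fundamental_form_symplectic hJ he); rewrite -muln2.
have be := adapted_basis he.
apply: (ip_eq0 (ip := ip)) => z; apply/eqP; rewrite -oppr_eq0; apply/eqP.
have wE := wedge_wedge_pow (fun Z : 'I_2 -> g => ip (br (Z ord0) (Z ord_max)) z)
  FE (@wedge_pow_symplectic _ _ m F).
rewrite (wedge_closed_unimodular (c := fun i x => ip x (E i)) (u := ip^~ z)) in wE.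
- move/esym/eqP: wE; rewrite mulf_eq0 mulf_eq0 invr_eq0 !pnatr_eq0 /=.
  rewrite -[_`! == 0%N]negbK -lt0n fact_gt0 /= => /eqP sum0.
  rewrite -(sumE _ (fun i => br e`_i (J e`_i))) linear_sumlz -sumrN -[RHS]sum0.
  apply: eq_bigr => i _; rewrite (adapted_J hJ he) ?ltE //.
  rewrite (bigD1 (Ordinal (@ltn_partner i m.+1 (ltn_ord i)))) //= big1 ?addr0.
    by rewrite /omega eqxx linearZ /= linearZl_LR /= mulNr opprK.
  by move=> j; rewrite -(inj_eq val_inj) /omega /= => /negPf ->; rewrite mul0r.
- exact: wedge_pow_alternating.
- exact/wedge_pow_multilinear/fundamental_form_multilinear.
- exact: bal.
- exact: ip_scalar.
- by move=> i; apply: ip_scalar.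
- move=> x; rewrite (sumE _ (fun i => ip x e`_i *: e`_i)).
  rewrite {1}(coord_basis be (memvf x)).
  by apply: eq_bigr => i _; rewrite (adapted_coord he).
- by move=> i j; rewrite (adapted_ip he) ?ltE // eq_sym.
move=> x; rewrite (sumE _ (fun i => ip (br x e`_i) e`_i)).
rewrite -[RHS](um x) (mxtrace_endmx_basis _ (vbasisP _) be).
by apply: eq_bigr => i _; rewrite mxE (adapted_coord he).
Qed.

(** * The Lie algebra su(n - k) and the holonomy *)

Section SpecialUnitary.
Variables (R : realType) (g : vectType R) (n k : nat) (br : lie_bracket g).
Variables (ip : {dot g for idfun}) (J : 'End(g)) (e : n.*2.-tuple g).
Hypothesis (hherm : is_hermitian br ip J).
Hypothesis (he : is_adapted_basis k br ip J e).
Implicit Types f h : 'End(g).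
Let Jm := endmx e J.

(** Written as a trace, the last condition defining [su(n)] is seen to be
    preserved by commutators. *)
Lemma skew_trace M : M^T = - M ->
  \tr (Jm *m M) = - 2 * \sum_(i < n) M (dbl_ord i) (dblS_ord i).
Proof.
move=> Msk; rewrite mxtrace_mulC /mxtrace sum_dbl_ord mulr_sumr.
apply: eq_bigr => h _.
have MJ (i j : 'I_n.*2) : partner i = j -> (M *m Jm) i i = - (-1) ^+ i * M i j.
  move=> ij; have Jj (l : 'I_n.*2) : Jm l i = - (-1) ^+ i * (j == l)%:R.
    rewrite mxE (adapted_coord he) (adapted_J hherm he) // linearZl_LR /=.
    by rewrite ij (adapted_ip he).
  rewrite mxE (bigD1 j) //= big1 => [|l nl].
    by rewrite Jj eqxx mulr1 addr0 mulrC.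
  by rewrite Jj eq_sym (negPf nl) !mulr0.
have Msw : M (dblS_ord h) (dbl_ord h) = - M (dbl_ord h) (dblS_ord h).
  have := congr1 (fun N : 'M_n.*2 => N (dbl_ord h) (dblS_ord h)) Msk.
  by rewrite !mxE.
rewrite (MJ _ (dblS_ord h)) ?(MJ (dblS_ord h) (dbl_ord h)).
- rewrite Msw /= -[_ ^+ h.*2]signr_odd -[_ ^+ h.*2.+1]signr_odd /= odd_double /=.
  by rewrite expr0 expr1 opprK mul1r mulN1r -opprD -mulr2n mulNr mulr_natl.
- by rewrite /partner /= odd_double.
- by rewrite /partner /= odd_double.
Qed.

Lemma in_su_subP M : in_su_sub k Jm M <->
  [/\ M^T = - M, M *m Jm = Jm *m M, \tr (Jm *m M) = 0 &
    forall i j : 'I_n.*2, ((n - k).*2 <= j)%N -> M i j = 0].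
Proof.
split=> [[[Msk MJ Mtr] M0]|[Msk MJ Mtr M0]].
  split=> //; first by rewrite skew_trace // Mtr mulr0.
  by move=> i j lj; rewrite M0 // lj orbT.
split; last first.
  move=> i j /orP[li|lj]; last exact: M0.
  have := congr1 (fun N : 'M_n.*2 => N j i) Msk; rewrite !mxE => ->.
  by rewrite M0 // oppr0.
split=> //; move/eqP: Mtr; rewrite skew_trace // mulf_eq0 oppr_eq0 pnatr_eq0 /=.
by move/eqP.
Qed.

Definition su_end f := in_su_sub k Jm (endmx e f).

Lemma su_end_lin c f h : su_end f -> su_end h -> su_end (c *: f + h).
Proof.
rewrite /su_end endmxD endmxZ; move: (endmx e f) (endmx e h) => A B.
rewrite !in_su_subP => -[AS AJ At A0] [BS BJ Bt B0]; split.
- by rewrite linearP /= AS BS scalerN opprD.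
- by rewrite mulmxDl mulmxDr -scalemxAl -scalemxAr AJ BJ.
- by rewrite mulmxDr -scalemxAr linearP /= At Bt mulr0 addr0.
- by move=> i j lj; rewrite !mxE A0 // B0 // mulr0 addr0.
Qed.

Lemma su_end0 : su_end 0.
Proof.
rewrite /su_end endmx0 in_su_subP; split=> [|||i j _].
- by rewrite trmx0 oppr0.
- by rewrite mul0mx mulmx0.
- by rewrite mulmx0 mxtrace0.
- by rewrite mxE.
Qed.

Lemma su_endB f h : su_end f -> su_end h -> su_end (f - h).
Proof.
by move=> suf suh; rewrite addrC -scaleN1r; apply: su_end_lin.
Qed.

Lemma su_end_sum I (r : seq I) (F : I -> 'End(g)) :
  (forall i, su_end (F i)) -> su_end (\sum_(i <- r) F i).
Proof.
move=> suF; elim: r => [|i r IHr]; first by rewrite big_nil; apply: su_end0.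
by rewrite big_cons -[F i]scale1r; apply: su_end_lin.
Qed.

Lemma su_end_comm f h : su_end f -> su_end h -> su_end (end_comm f h).
Proof.
have be := adapted_basis he.
rewrite /su_end /end_comm -[- _]scaleN1r addrC endmxD endmxZ !endmx_comp //.
rewrite scaleN1r addrC.
move: (endmx e f) (endmx e h) => A B.
rewrite !in_su_subP => -[AS AJ At A0] [BS BJ Bt B0]; split.
- by rewrite linearB /= !trmx_mul AS BS !mulNmx !mulmxN !opprK opprB.
- rewrite mulmxBl mulmxBr -!mulmxA AJ BJ.
  by rewrite !mulmxA AJ BJ.
- rewrite mulmxBr linearB /= [Jm *m (B *m A)]mulmxA -BJ -mulmxA.
  by rewrite [\tr (B *m _)]mxtrace_mulC mulmxA subrr.
- move=> i j lj; rewrite !mxE !big1 ?subr0 // => l _.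
    by rewrite A0 // mulr0.
  by rewrite B0 // mulr0.
Qed.

Lemma lie_generated_su (S : 'End(g) -> Prop) f :
  (forall h, S h -> su_end h) -> lie_generated S f -> su_end f.
Proof.
move=> suS; elim=> {f} [f|//|c f h _ suf _ suh|f h _ suf _ suh].
- exact: suS.
- exact: su_end0.
- exact: su_end_lin.
- exact: su_end_comm.
Qed.

(** By induction on the order of the covariant derivative: every summand of
    [nabla S] is a commutator of [nabla_x] with a value of [S], or a value of
    [S]. *)
Lemma hol_su (nabla : 'Hom(g, 'End(g))) f :
  (forall x, su_end (nabla x)) -> hol br nabla f -> su_end f.
Proof.
move=> sun; apply: lie_generated_su => h [r [X ->]].
elim: r X => [|r IHr] X.
  apply: su_endB; last exact: sun.
  by apply: su_end_comm; apply: sun.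
apply: su_endB; first by apply: su_end_comm => //; apply: sun.
by apply: su_end_sum => i; apply: IHr.
Qed.

Lemma bismut_su nabla x :
  unimodular br -> is_abelian_structure br J -> is_balanced n br ip J ->
  is_bismut br ip J nabla -> su_end (nabla x).
Proof.
move=> um ab bal hn; have nE y z := bismutE hherm x y z ab hn.
have be := adapted_basis he.
rewrite /su_end in_su_subP; split.
- apply/matrixP => i j; rewrite !mxE !(adapted_coord he) !nE.
  by rewrite lie_antisym linearNr.
- rewrite -!endmx_comp //; congr (endmx e _); apply/lfunP => y.
  rewrite !comp_lfunE; apply/eqP; rewrite -subr_eq0; apply/eqP.
  apply: (ip_eq0 (ip := ip)) => z.
  suff -> : ip (nabla x (J y) - J (nabla x y)) z
      = ip (nabla x (J y)) z - ip (J (nabla x y)) z.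
    (* [Jy, z] + [y, Jz] = 0, by abelianness at the pair (Jy, z). *)
    rewrite (herm_skew hherm) !nE opprK -ab.
    by have [[J2 _] _] := hherm; rewrite J2 linearN opp_lfunE linearNr opprK subrr.
  exact: linearBl.
- rewrite -endmx_comp // /mxtrace.
  rewrite (eq_bigr (fun i : 'I_n.*2 => ip x (br e`_i (J e`_i)))) => [|i _].
    by rewrite -linear_sumr (balanced_sum um hherm bal he) linear0r.
  by rewrite mxE (adapted_coord he) comp_lfunE (herm_skew hherm) nE opprK.
move=> i j lj; rewrite mxE (adapted_coord he) nE.
have : e`_j \in center br.
  case: he => _ _ _ <-; apply: memv_span.
  rewrite -(subnKC lj) -nth_drop mem_nth // size_drop size_tuple.
  by have := ltn_ord j; lia.
by rewrite memv_ker => /eqP ->; rewrite zero_lfunE linear0r oppr0.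
Qed.

End SpecialUnitary.

Theorem theorem3p12 (R : realType) (g : vectType R) (n k : nat)
  (br : lie_bracket g) (ip : {dot g for idfun}) (J : 'End(g))
  (nabla : 'Hom(g, 'End(g))) (e : n.*2.-tuple g)
  (hdim : \dim {:g} = n.*2)
  (hunim : unimodular br)
  (hherm : is_hermitian br ip J)
  (habel : is_abelian_structure br J)
  (hbal : is_balanced n br ip J)
  (hnabla : is_bismut br ip J nabla)
  (hcenter : \dim (center br) = k.*2)
  (he : is_adapted_basis k br ip J e) :
  forall A : 'End(g), hol br nabla A ->
    in_su_sub k (endmx e J) (endmx e A).
Proof.
move=> A; apply: (hol_su hherm he) => x.
exact: bismut_su hunim habel hbal hnabla.
Qed.
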